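(* Let $n$ be a large enough integer and let $F_{\mathsf{full\text{-}rank}}:\{0,1\}^{n\times n}\to\{0,1\}$ be the indicator function of whether the given matrix has full rank over $\mathbb{F}_2$. Suppose there are $n$ processors, and the $i$-th processor is given the $i$-th row of the input matrix. Then for every $\mathsf{BCAST}(1)$ protocol with at most $n/20$ rounds and every processor $i$, the output of processor $i$ at the end of the protocol equals $F_{\mathsf{full\text{-}rank}}(A)$ with probability at most $0.99$ when the input $A$ is uniformly random in $\{0,1\}^{n\times n}$.
   Context: In the $\mathsf{BCAST}(1)$ (Broadcast Congested Clique) model there are $n$ processors numbered $1,\dots,n$, each holding a private input string and having unlimited computational power. Computation proceeds in synchronous rounds; in each round every processor broadcasts a single bit (the same bit to all processors), which may depend on its index, its input, its random bits (independent of the inputs) and all bits broadcast in previous rounds. At the end a processor's output is a function of its input, its random bits and all broadcast bits. *)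

(* Defs.v *)
From HB Require Import structures.
From mathcomp Require Import all_boot all_order all_algebra.
From mathcomp Require Import all_classical all_reals all_analysis.
Set Implicit Arguments.
Unset Strict Implicit.
Unset Printing Implicit Defensive.
Import Order.TTheory GRing.Theory Num.Theory.
Local Open Scope classical_set_scope.
Local Open Scope ring_scope.

Definition bit_events : set (set (nat -> bool)) :=
  [set B | exists k : nat, B = [set c : nat -> bool | c k]].

(* Unbounded strings of random bits, with the product sigma-algebra. *)
Notation bits := (g_sigma_algebraType bit_events).

(* The bits broadcast by the n processors in the rounds played so far, one
   entry per round, in chronological order. *)
Notation history n := (seq {ffun 'I_n -> bool}).

(* A BCAST(1) protocol for n processors with inputs in X.  The functions are
   arbitrary (no bound on computational power), apart from being measurable in
   the random bits so that probabilities make sense.  The round number is the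
   size of the history. *)
Record protocol (n : nat) (X : Type) := Protocol {
  rounds : nat;
  broadcast : 'I_n -> X -> bits -> history n -> bool;
  output : 'I_n -> X -> bits -> history n -> bool;
  measurable_broadcast : forall i x h,
    measurable_fun [set: bits] (fun c => broadcast i x c h);
  measurable_output : forall i x h,
    measurable_fun [set: bits] (fun c => output i x c h)
}.

Section Execution.
Variables (n : nat) (X : Type) (p : protocol n X).
Variables (x : 'I_n -> X) (c : 'I_n -> bits).

Fixpoint transcript (t : nat) : history n :=
  if t is s.+1 then
    let h := transcript s in
    rcons h [ffun i => broadcast p i (x i) (c i) h]
  else [::].

Definition final_output (i : 'I_n) : bool :=
  output p i (x i) (c i) (transcript (rounds p)).

End Execution.

Definition full_rank (n : nat) (M : 'M['F_2]_n) : bool := \rank M == n.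

Section RandomInput.
Context {d : measure_display} {Omega : measurableType d} {R : realType}.
Variables (P : probability Omega R) (n : nat).

Definition uniform_matrix (A : Omega -> 'M['F_2]_n) : Prop :=
  forall M : 'M['F_2]_n,
    measurable (A @^-1` [set M]) /\
    P (A @^-1` [set M]) = ((#|{: 'M['F_2]_n}|%:R)^-1)%:E.

(* g_sigma_preimage c is the sigma-algebra generated by the random bits of all
   the processors; A takes finitely many values, so its atoms suffice. *)
Definition independent_of_bits (A : Omega -> 'M['F_2]_n)
    (c : 'I_n -> Omega -> bits) : Prop :=
  forall (M : 'M['F_2]_n) (E : set Omega), g_sigma_preimage c E ->
    P (A @^-1` [set M] `&` E) = (P (A @^-1` [set M]) * P E)%E.

End RandomInput.

(* Main.v *)
Require Import Defs.
From HB Require Import structures.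
From mathcomp Require Import all_boot all_order all_algebra.
From mathcomp Require Import all_classical all_reals all_analysis.
From mathcomp Require Import measurable_realfun zify ring lra.
Set Implicit Arguments.
Unset Strict Implicit.
Unset Printing Implicit Defensive.
Import Order.TTheory GRing.Theory Num.Theory.
Local Open Scope ring_scope.

(* Fix the random bits.  The matrices producing a given transcript form a
   rectangle, a product of sets S_j of rows.  For a nonzero vector b, the
   fraction of the rectangle that is annihilated by b is
   2^-n prod_j (1 + delta_j(b)), where delta_j(b) is the mean of (-1)^(x.b) over
   x in S_j, and this is at least 2^-n (1 - sum_j |delta_j(b)|).  By Parseval the
   sum over b of delta_j(b)^2 is 2^n / |S_j|, and for t rounds the average of
   1 / |S_j| over a uniform matrix is at most 2^t / 2^n.  Hence, if k(A) counts
   the nonzero vectors of the kernel of A, then E[k; output is 1] is at least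
   P(output is 1) - o(1): the protocol cannot tell a uniform matrix from one with
   a planted kernel vector.  But k = 0 on invertible matrices and E[k^2] <= 2, so
   the output must be 1 on many singular matrices: since k <= 2 + k^2/8, the
   error probability is at least P(full rank) - 1/4 - o(1) > 0.273 - 0.25 - o(1). *)

(** * Characters of ['F_2] and Fourier analysis of sets of rows *)

Section Characters.
Variable R : realFieldType.

Definition chi (a : 'F_2) : R := (-1) ^+ (a != 0).

Lemma F2_cases (a : 'F_2) : a = 0 \/ a = 1.
Proof. by case: a => [[|[|//]]] i; [left|right]; apply/val_inj. Qed.

Lemma chiD a b : chi (a + b) = chi a * chi b.
Proof.
by case: (F2_cases a) => ->; case: (F2_cases b) => ->;
  rewrite /chi /= ?addr0 ?add0r ?mulN1r ?mulr1 ?mul1r ?opprK.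
Qed.

Lemma natr_eq0_chi a : (a == 0)%:R = (1 + chi a) / 2 :> R.
Proof. by rewrite /chi; case: (a == 0) => /=; rewrite ?expr0 ?expr1; field. Qed.

Definition dot n (x : 'rV['F_2]_n) (b : 'cV['F_2]_n) : 'F_2 := (x *m b) 0 0.

Lemma card_F2 : #|'F_2| = 2%N. Proof. exact: card_Fp. Qed.

Lemma sum_chi_dot n (x : 'rV['F_2]_n) :
  \sum_b chi (dot x b) = (x == 0)%:R * 2 ^+ n.
Proof.
case: eqVneq => [->|/rV0Pn [k xk]].
  rewrite (eq_bigr (fun=> 1)) => [|b _]; last first.
    by rewrite /dot mul0mx mxE /chi eqxx.
  by rewrite sumr_const cardT -cardE card_mx card_F2 muln1 mul1r natrX.
have xk1 : x 0 k = 1 by case: (F2_cases (x 0 k)) xk => -> //; rewrite eqxx.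
rewrite mul0r; set s := LHS.
suff : s = - s by lra.
(* Shifting [b] by the basis vector of a coordinate where [x] is 1 flips every sign. *)
rewrite /s {1}(reindex_inj (addrI (delta_mx k 0))) /= -sumrN.
apply: eq_bigr => b _; rewrite /dot mulmxDr mxE chiD -colE mxE xk1.
by rewrite /chi oner_eq0 /= expr1 mulN1r.
Qed.

Lemma sum_chi_dotl n (b : 'cV['F_2]_n) :
  \sum_x chi (dot x b) = (b == 0)%:R * 2 ^+ n.
Proof.
rewrite -(trmx_eq0 b) -sum_chi_dot.
rewrite (reindex (@trmx _ n 1)) /=; last first.
  by exists (@trmx _ 1 n) => y _; rewrite trmxK.
apply: eq_bigr => x _.
by rewrite /dot -[in RHS](trmxK x) -trmx_mul [in RHS]mxE.
Qed.

(** The unnormalized Fourier coefficient at [b] of the indicator of [S]. *)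
Definition bias n (S : {pred 'rV['F_2]_n}) b := \sum_(x in S) chi (dot x b).

(** Expanding the square gives characters of [x + y]; by orthogonality only [x + y = 0] survives,
    that is [x = y] in characteristic 2. *)
Lemma bias_parseval n (S : {pred 'rV['F_2]_n}) :
  \sum_b bias S b ^+ 2 = 2 ^+ n * #|S|%:R.
Proof.
have dotE x y b : chi (dot x b) * chi (dot y b) = chi (dot (x + y) b).
  by rewrite -chiD /dot mulmxDl [in RHS]mxE.
under eq_bigr => b _ do rewrite expr2 big_distrlr /=.
rewrite exchange_big /= mulrC -sum1_card natr_sum mulr_suml.
apply: eq_bigr => x Sx; rewrite exchange_big /= mul1r (bigD1 x) //=.
under eq_bigr => b _ do rewrite dotE.
have xx (z : 'rV['F_2]_n) : z + z = 0.
  by apply/rowP => k; rewrite !mxE; case: (F2_cases (z 0 k)) => ->; apply/val_inj.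
rewrite sum_chi_dot xx eqxx mul1r big1 ?addr0 // => y /andP[_ yx].
under eq_bigr => b _ do rewrite dotE.
rewrite sum_chi_dot; case: eqP; last by rewrite mul0r.
by move=> xy; case/eqP: yx; rewrite -(addr0 y) -(xx x) addrCA addrA xy add0r.
Qed.

Lemma bias_le n (S : {pred 'rV['F_2]_n}) b : `|bias S b| <= #|S|%:R.
Proof.
rewrite -sum1_card natr_sum; apply: le_trans (ler_norm_sum _ _ _) _.
by apply: ler_sum => x _; rewrite /chi normrX normrN1 expr1n.
Qed.

Lemma sum_dot_eq0 n (S : {pred 'rV['F_2]_n}) b :
  \sum_x ((x \in S) && (dot x b == 0))%:R = (#|S|%:R + bias S b) / 2.
Proof.
rewrite -sum1_card natr_sum -big_split /= mulr_suml [RHS]big_mkcond /=.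
by apply: eq_bigr => x _; case: (x \in S); rewrite //= natr_eq0_chi.
Qed.

(** Choosing a matrix amounts to choosing its rows independently, so this is distributivity. *)
Lemma sum_mx_rows n m (F : 'I_n -> 'rV['F_2]_m -> R) :
  \sum_(A : 'M['F_2]_(n, m)) \prod_j F j (row j A) = \prod_j \sum_x F j x.
Proof.
rewrite bigA_distr_bigA /=.
pose g (A : 'M['F_2]_(n, m)) : {ffun 'I_n -> 'rV['F_2]_m} := [ffun j => row j A].
rewrite (reindex g) /=.
  by apply: eq_bigr => A _; apply: eq_bigr => j _; rewrite ffunE.
exists (fun f : {ffun 'I_n -> 'rV['F_2]_m} => \matrix_(j, k) f j 0 k) => [A|f] _.
  by apply/matrixP => j k; rewrite mxE ffunE mxE.
by apply/ffunP => j; rewrite ffunE; apply/rowP => k; rewrite !mxE.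
Qed.

Lemma natr_forall (I : finType) (P : pred I) :
  [forall j, P j]%:R = \prod_j (P j)%:R :> R.
Proof.
case: (boolP [forall j, P j]) => [/forallP h|/forallPn [j /negbTE h]].
  by rewrite big1 // => j _; rewrite h.
by rewrite (bigD1 j) //= h mul0r.
Qed.

Lemma mulmx_eq0_row n (A : 'M['F_2]_n) (b : 'cV['F_2]_n) :
  (A *m b == 0) = [forall j, dot (row j A) b == 0].
Proof.
apply/eqP/forallP => [h j|h].
  by rewrite /dot -row_mul h row0 mxE.
by apply/colP => j; have := h j; rewrite /dot -row_mul mxE => /eqP ->; rewrite mxE.
Qed.

Lemma prod_1D_ge (I : finType) (d : I -> R) :
  (forall j, `|d j| <= 1) -> 1 - \sum_j `|d j| <= \prod_j (1 + d j).
Proof.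
move=> d1.
(* A nonnegative product allows [1 + d j] to be lowered to [1 - |d j|]; a nonnegative sum allows the
   cross term to be dropped. *)
suff /and3P[] : [&& 0 <= \sum_j `|d j|, 0 <= \prod_j (1 + d j)
    & 1 - \sum_j `|d j| <= \prod_j (1 + d j)] by [].
elim/big_rec2: _ => [|j s p _ /and3P[s0 p0 ps]].
  by rewrite lexx ler01 subr0 lexx.
have := d1 j; have := normr_ge0 (d j); have := ler_norm (- d j); rewrite normrN.
move: `|d j| => m dm m0 m1; apply/and3P; split; first lra.
  by apply: mulr_ge0 => //; lra.
have : 0 <= (1 + d j - (1 - m)) * p by apply: mulr_ge0 => //; lra.
have : 0 <= (1 - m) * (p - (1 - s)) by apply: mulr_ge0; lra.
have : 0 <= m * s by exact: mulr_ge0.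
lra.
Qed.
End Characters.

(** * Second moment of the kernel count, and sizes of rectangles *)

Section Kernels.
Variables (R : realFieldType) (n : nat).
Implicit Types (A : 'M['F_2]_n) (b : 'cV['F_2]_n).

Definition ker_count A : R := \sum_(b : 'cV['F_2]_n | b != 0) (A *m b == 0)%:R.

Lemma natr_card_mx m p : #|{: 'M['F_2]_(m, p)}|%:R = 2 ^+ (m * p) :> R.
Proof. by rewrite card_mx card_F2 natrX. Qed.

(** Distinct nonzero [b] and [c] are linearly independent over ['F_2], so both lie in the kernel
    with probability [4^-n]; a diagonal pair has probability [2^-n]. There are at most [4^n] pairs
    of the first kind and [2^n] of the second. *)
Lemma sum_ker_count_sqr : \sum_(A : 'M['F_2]_n) ker_count A ^+ 2 <= 2 * #|{: 'M['F_2]_n}|%:R.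
Proof.
have pair b c : b != 0 -> c != 0 ->
    \sum_(A : 'M['F_2]_n) (A *m b == 0)%:R * (A *m c == 0)%:R
    <= 2 ^+ (n * n) * ((b == c)%:R / 2 ^+ n + 1 / 2 ^+ n / 2 ^+ n) :> R.
  move=> b0 c0.
  rewrite (eq_bigr (fun A => \prod_j ((1 + chi R (dot (row j A) b)) / 2 *
      ((1 + chi R (dot (row j A) c)) / 2)))); last first.
    move=> A _; rewrite !mulmx_eq0_row !natr_forall -big_split /=.
    by apply: eq_bigr => j _; rewrite !natr_eq0_chi.
  rewrite (sum_mx_rows (fun _ x => (1 + chi R (dot x b)) / 2 * ((1 + chi R (dot x c)) / 2))).
  have -> : \prod_(j < n) \sum_x (1 + chi R (dot x b)) / 2 * ((1 + chi R (dot x c)) / 2)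
      = (2 ^+ n * (1 + (b == c)%:R) / 4) ^+ n :> R.
    rewrite prodr_const card_ord; congr (_ ^+ n).
    (* Besides the trivial character, only that of [b + c] can have a nonzero sum, namely when
       [b = c]. *)
    transitivity (\sum_x (1 + chi R (dot x b) + chi R (dot x c) + chi R (dot x (b + c))) / 4).
      apply: eq_bigr => x _; rewrite /(dot x (b + c)) mulmxDr mxE chiD -!/(dot _ _).
      by field.
    rewrite -mulr_suml !big_split /= !sum_chi_dotl (negbTE b0) (negbTE c0).
    rewrite sumr_const cardT -cardE natr_card_mx mul1n !mul0r !addr0 mulrDr mulr1.
    rewrite addr_eq0 [(- c)](_ : _ = c) 1?(mulrC (_%:R)) //.
    by apply/colP => k; rewrite mxE; case: (F2_cases (c k 0)) => ->; apply/val_inj.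
  have e4 : (4 : R) ^+ n = 2 ^+ n * 2 ^+ n by rewrite -exprMn; congr (_ ^+ n); ring.
  have n2 : (2 : R) ^+ n > 0 by rewrite exprn_gt0.
  rewrite exprM; set N : R := 2 ^+ n in e4 n2 *.
  have U0 : 0 < N ^+ n by rewrite exprn_gt0.
  rewrite !exprMn exprVn e4 -mulrA ler_pM2l //.
  have -> : (1 + (b == c)%:R) ^+ n = (if b == c then N else 1) :> R.
    by case: (b == c); rewrite ?addr0 ?expr1n.
  case: (b == c).
    rewrite (_ : N / (N * N) = 1 / N); last by field; rewrite gt_eqF.
    by rewrite lerDl -mulrA mul1r mulr_ge0 // invr_ge0 ltW.
  by rewrite mul0r add0r !mul1r invfM.
under eq_bigr => A _ do rewrite expr2 big_distrlr /=.
rewrite exchange_big /=; under eq_bigr => b _ do rewrite exchange_big /=.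
have n2 : (2 : R) ^+ n != 0 by rewrite gt_eqF // exprn_gt0.
apply: (@le_trans _ _ (\sum_(b : 'cV['F_2]_n) \sum_c
    2 ^+ (n * n) * ((b == c)%:R / 2 ^+ n + 1 / 2 ^+ n / 2 ^+ n))).
  rewrite [leRHS](bigID (fun b : 'cV['F_2]_n => b != 0)) /= ler_wpDr //.
    do 2!apply: sumr_ge0 => ? _.
    by rewrite mulr_ge0 ?addr_ge0 // ?divr_ge0 // exprn_ge0.
  apply: ler_sum => b b0.
  rewrite [leRHS](bigID (fun b : 'cV['F_2]_n => b != 0)) /= ler_wpDr //.
    apply: sumr_ge0 => ? _.
    by rewrite mulr_ge0 ?addr_ge0 // ?divr_ge0 // exprn_ge0.
  by apply: ler_sum => c c0; exact: pair.
have row_sum b :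
    \sum_(c : 'cV['F_2]_n) ((b == c)%:R / 2 ^+ n + 1 / 2 ^+ n / 2 ^+ n) = 2 / 2 ^+ n :> R.
  rewrite big_split /= sumr_const cardT -cardE -[X in _ + X]mulr_natr natr_card_mx muln1.
  rewrite -mulr_suml (bigD1 b) //= eqxx big1 ?addr0 /=; first by rewrite divfK //; field.
  by move=> c; rewrite eq_sym => /negbTE ->.
under eq_bigr => b _ do rewrite -mulr_sumr row_sum.
rewrite sumr_const cardT -cardE -[leLHS]mulr_natr !natr_card_mx muln1.
by rewrite le_eqVlt; apply/orP; left; apply/eqP; field.
Qed.

(* A canonical point of [S]; the zero row, possibly outside [S], if [S] is empty. *)
Definition rep (S : {pred 'rV['F_2]_n}) : 'rV['F_2]_n := odflt 0 [pick x in S].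

Definition in_rect (S : 'I_n -> {pred 'rV['F_2]_n}) A := [forall j, row j A \in S j].

Lemma sum_in_rect S : \sum_(A : 'M['F_2]_n) (in_rect S A)%:R = \prod_j #|S j|%:R :> R.
Proof.
transitivity (\sum_(A : 'M['F_2]_n) \prod_j (row j A \in S j)%:R : R).
  by apply: eq_bigr => A _; exact: natr_forall.
rewrite (sum_mx_rows (fun j x => (x \in S j)%:R)); apply: eq_bigr => j _.
by rewrite -sum1_card natr_sum [RHS]big_mkcond; apply: eq_bigr => x _; case: (x \in S j).
Qed.

(** Turns the [1 / |S_j|] from Parseval into a count of matrices, which an injection can bound over
    all transcripts at once. For empty [S j] both sides vanish. *)
Lemma sum_in_rect_rep S j :
  \sum_(A : 'M['F_2]_n) (in_rect S A && (row j A == rep (S j)))%:R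
  = (\prod_k #|S k|%:R) / #|S j|%:R :> R.
Proof.
pose Q k x := (x \in S k) && ((k == j) ==> (x == rep (S j))).
have QE A : in_rect S A && (row j A == rep (S j)) = in_rect Q A.
  apply/andP/forallP => [[/forallP h hj] k|h].
    by rewrite unfold_in /Q h; apply/implyP => /eqP ->.
  split; last by have := h j; rewrite unfold_in /Q eqxx => /andP[].
  by apply/forallP => k; have := h k; rewrite unfold_in => /andP[].
transitivity (\sum_(A : 'M['F_2]_n) (in_rect Q A)%:R : R).
  by apply: eq_bigr => A _; rewrite QE.
rewrite sum_in_rect (bigD1 j) //= [in RHS](bigD1 j) //= mulrAC; congr (_ * _).
  have [S0|S0] := eqVneq #|S j| 0%N.
    have : (#|Q j| <= #|S j|)%N.
      by apply: subset_leq_card; apply/fintype.subsetP => x; rewrite unfold_in => /andP[].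
    by rewrite S0 leqn0 => /eqP ->; rewrite mul0r.
  rewrite divff ?pnatr_eq0 // (eq_card (B := pred1 (rep (S j)))) ?card1 // => x.
  rewrite [x \in Q j]unfold_in /Q eqxx inE /=; case: eqP => [->|]; rewrite ?andbF // andbT.
  rewrite /rep; case: pickP => //= x0; case/eqP: S0; exact: eq_card0.
apply: eq_bigr => k /negbTE kj; congr _%:R; apply: eq_card => x.
by rewrite [LHS]unfold_in /Q kj andbT.
Qed.

End Kernels.

(** * Kernel vectors of the matrices in a rectangle *)

Section Rectangles.
Variables (R : realFieldType) (n : nat).

Lemma sum_in_rect_ker (S : 'I_n -> {pred 'rV['F_2]_n}) (b : 'cV['F_2]_n) :
  2 ^+ n * \sum_(A : 'M['F_2]_n) (in_rect S A)%:R * (A *m b == 0)%:R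
  = \prod_j (#|S j|%:R + bias R (S j) b) :> R.
Proof.
have -> : \sum_(A : 'M['F_2]_n) (in_rect S A)%:R * (A *m b == 0)%:R
    = \sum_(A : 'M['F_2]_n) \prod_j ((row j A \in S j) && (dot (row j A) b == 0))%:R :> R.
  apply: eq_bigr => A _; rewrite mulmx_eq0_row /in_rect !natr_forall -big_split /=.
  by apply: eq_bigr => j _; rewrite -natrM mulnb.
rewrite (sum_mx_rows (fun j x => ((x \in S j) && (dot x b == 0))%:R)).
rewrite -[in 2 ^+ n](card_ord n) -prodr_const -big_split /=; apply: eq_bigr => j _.
by rewrite sum_dot_eq0 mulrCA divff ?mulr1.
Qed.

(** For each [b] the product of the [1 + delta j b] is at least one minus the sum of the
    [|delta j b|]; these are then bounded through their squares, so that Parseval applies to the sum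
    over [b]. The parameter [eps] balances the two error terms. *)
Lemma rect_ker_count_ge (S : 'I_n -> {pred 'rV['F_2]_n}) (eps : R) : 0 < eps ->
  \sum_(A : 'M['F_2]_n) (in_rect S A)%:R * (2 ^+ n - 1 - 2 ^+ n * n%:R * eps / 2)
    - 2 ^+ n / (2 * eps) *
      \sum_j \sum_(A : 'M['F_2]_n) (in_rect S A && (row j A == rep (S j)))%:R
  <= 2 ^+ n * \sum_(A : 'M['F_2]_n) (in_rect S A)%:R * ker_count R A.
Proof.
move=> eps0; rewrite -mulr_suml sum_in_rect.
set r : R := \prod_j _.
have r0 : 0 <= r by apply: prodr_ge0.
pose delta j b : R := bias R (S j) b / #|S j|%:R.
have -> : 2 ^+ n * \sum_(A : 'M['F_2]_n) (in_rect S A)%:R * ker_count R A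
    = \sum_(b : 'cV['F_2]_n | b != 0) r * \prod_j (1 + delta j b).
  rewrite /ker_count; under eq_bigr => A _ do rewrite mulr_sumr.
  rewrite exchange_big mulr_sumr; apply: eq_bigr => b _ /=.
  rewrite sum_in_rect_ker -big_split; apply: eq_bigr => j _ /=.
  (* For empty [S j] the bias is 0, and so is [delta] by the convention on division by 0. *)
  rewrite mulrDr mulr1 /delta; have [S0|S0] := eqVneq (#|S j|%:R : R) 0.
    by have := bias_le R (S j) b; rewrite S0 normr_le0 => /eqP ->; rewrite !mul0r.
  by rewrite mulrCA divff ?mulr1.
have delta1 j b : `|delta j b| <= 1.
  rewrite normrM normfV normr_nat; have [S0|S0] := eqVneq (#|S j|%:R : R) 0.
    by rewrite S0 invr0 mulr0.
  by rewrite ler_pdivrMr ?mul1r ?bias_le // lt_neqAle eq_sym S0 /=.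
have sum_delta j : \sum_(b : 'cV['F_2]_n) delta j b ^+ 2 = 2 ^+ n / #|S j|%:R.
  rewrite /delta; under eq_bigr => b _ do rewrite exprMn.
  rewrite -mulr_suml bias_parseval; have [->|S0] := eqVneq (#|S j|%:R : R) 0.
    by rewrite invr0 expr0n /= !mulr0.
  by field.
have amgm (d : R) : `|d| <= eps / 2 + d ^+ 2 / (2 * eps).
  have : 0 <= (`|d| - eps) ^+ 2 / (2 * eps).
    by rewrite mulr_ge0 ?sqr_ge0 ?invr_ge0 ?mulr_ge0 ?ltW.
  rewrite -(real_normK (num_real d)).
  rewrite (_ : (`|d| - eps) ^+ 2 / (2 * eps) = eps / 2 + `|d| ^+ 2 / (2 * eps) - `|d|).
    by rewrite subr_ge0.
  by field; rewrite gt_eqF.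
have -> : \sum_j \sum_(A : 'M['F_2]_n) (in_rect S A && (row j A == rep (S j)))%:R
    = \sum_j r / #|S j|%:R :> R.
  by apply: eq_bigr => j _; rewrite sum_in_rect_rep.
apply: (@le_trans _ _ (\sum_(b : 'cV['F_2]_n | b != 0) r * (1 - \sum_j `|delta j b|))); last first.
  apply: ler_sum => b _; rewrite ler_wpM2l //; exact: prod_1D_ge.
rewrite -!mulr_sumr mulrCA -mulrBr ler_wpM2l //.
have n2 : 0 < 2 ^+ n :> R by rewrite exprn_gt0.
have nz1 : \sum_(b : 'cV['F_2]_n | b != 0) 1 = 2 ^+ n - 1 :> R.
  rewrite -[2 ^+ n](_ : \sum_(b : 'cV['F_2]_n) 1 = _).
    by rewrite [in RHS](bigD1 0) //= addrAC subrr add0r.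
  by rewrite sumr_const cardT -cardE natr_card_mx muln1.
rewrite sumrB nz1.
(* The term [b = 0] is put back to obtain the complete Parseval sum. *)
have : \sum_(b : 'cV['F_2]_n | b != 0) \sum_j `|delta j b| <=
    \sum_(b : 'cV['F_2]_n) \sum_j (eps / 2 + delta j b ^+ 2 / (2 * eps)).
  rewrite [leRHS](bigID (fun b => b != 0)) /= ler_wpDr //.
    by do 2!apply: sumr_ge0 => ? _; rewrite (le_trans _ (amgm _)).
  by do 2!apply: ler_sum => ? _.
rewrite [leRHS]exchange_big /=.
have inner j : \sum_(b : 'cV['F_2]_n) (eps / 2 + delta j b ^+ 2 / (2 * eps))
    = 2 ^+ n * eps / 2 + 2 ^+ n / (2 * eps) * #|S j|%:R^-1.
  rewrite big_split /= -[X in _ + X]mulr_suml sum_delta sumr_const cardT -cardE.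
  by rewrite -[X in X + _]mulr_natl natr_card_mx muln1 !mulrA; congr (_ + _); exact: mulrAC.
under [leRHS]eq_bigr => j _ do rewrite inner.
rewrite big_split /= sumr_const card_ord -[_ *+ n]mulr_natr.
rewrite -mulr_sumr.
set s := \sum_j #|_|%:R^-1; set t := \sum_(b | _) _.
have -> : 2 ^+ n * eps / 2 * n%:R = 2 ^+ n * n%:R * eps / 2 by ring.
lra.
Qed.

End Rectangles.

(** * The density of invertible matrices *)

Section FullRankDensity.
Variable R : realFieldType.

Lemma card_full_rank n : (0 < n)%N ->
  #|[pred A : 'M['F_2]_n | full_rank A]|
  = (2 ^ 'C(n, 2) * \prod_(1 <= i < n.+1) (2 ^ i - 1))%N.
Proof.
case: n => // n _; have := card_GL 'F_2 (ltn0Sn n); rewrite card_F2 => <-.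
rewrite cardsT card_sub; apply: eq_card => A.
by rewrite !unfold_in /full_rank -[LHS]/(row_free A) row_free_unit.
Qed.

Lemma natr_GL_product n :
  (2 ^ 'C(n, 2) * \prod_(1 <= i < n.+1) (2 ^ i - 1))%:R
  = 2 ^+ (n * n) * \prod_(1 <= i < n.+1) (1 - (2 ^+ i)^-1) :> R.
Proof.
elim: n => [|n IHn]; first by rewrite !big_geq // muln1 muln0 mulr1.
rewrite big_nat_recr //= [in RHS]big_nat_recr //= binS bin1 expnD.
rewrite (_ : _ * _ = (2 ^ 'C(n, 2) * \prod_(1 <= i < n.+1) (2 ^ i - 1))
  * 2 ^ n * (2 ^ n.+1 - 1))%N; last by lia.
rewrite 2!natrM IHn natrB ?expn_gt0 // !natrX.
rewrite (_ : n.+1 * n.+1 = n * n + n + n.+1)%N; last by lia.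
by rewrite !exprD exprS; field; rewrite expf_neq0.
Qed.

(* The factor [1 + 2 / 2 ^+ n] makes the induction go through. *)
Lemma prod_1B_half_ge n : (4 <= n)%N ->
  273 / 1000 * (1 + 2 / 2 ^+ n) <= \prod_(1 <= i < n.+1) (1 - (2 ^+ i)^-1) :> R.
Proof.
elim: n => // n IHn; rewrite leq_eqVlt => /predU1P[<-|n4].
  (* At 4 the product is 315/1024, just above the required 0.307125. *)
  by rewrite /index_iota /= !big_cons big_nil; lra.
rewrite big_nat_recr //=; set p := \prod_(_ <= _ < _) _ in IHn *.
have := IHn n4; rewrite exprS invfM; have : (2 ^+ n)^-1 <= 2^-1 ^+ 4 :> R.
  by rewrite -exprVn ler_wiXn2l //; lra.
have : 0 <= (2 ^+ n)^-1 :> R by rewrite invr_ge0 exprn_ge0.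
move: (2 ^+ n)^-1 => x x0 x1 px.
have : 273 / 1000 * (1 + 2 * x) * (1 - 2^-1 * x) <= p * (1 - 2^-1 * x).
  by apply: ler_wpM2r => //; lra.
(* It remains that [(1 + 2 * x) * (1 - x / 2) >= 1 + x], true for [x] between 0 and 1/2. *)
by nra.
Qed.

Lemma full_rank_density n : (4 <= n)%N ->
  273 / 1000 * 2 ^+ (n * n) <= \sum_(A : 'M['F_2]_n) (full_rank A)%:R :> R.
Proof.
move=> n4; have -> : \sum_(A : 'M['F_2]_n) (full_rank A)%:R
    = #|[pred A : 'M['F_2]_n | full_rank A]|%:R :> R.
  by rewrite -sum1_card natr_sum [RHS]big_mkcond; apply: eq_bigr => A _; rewrite inE; case: ifP.
rewrite card_full_rank; last by lia.
rewrite natr_GL_product mulrC ler_wpM2l ?exprn_ge0 //.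
apply: le_trans (prod_1B_half_ge n4).
have : 0 <= (2 ^+ n)^-1 :> R by rewrite invr_ge0 exprn_ge0.
lra.
Qed.

End FullRankDensity.

(** * Deterministic protocols and their transcripts *)

Section Play.
Variables (n : nat) (X : Type) (bc : 'I_n -> X -> history n -> bool).
Implicit Types (x : 'I_n -> X) (h : history n).

Fixpoint play x (t : nat) : history n :=
  if t is s.+1 then
    let h := play x s in rcons h [ffun j => bc j (x j) h]
  else [::].

Lemma size_play x t : size (play x t) = t.
Proof. by elim: t => //= t IHt; rewrite size_rcons IHt. Qed.

(** The side at coordinate [j] of the rectangle of [h]. The default value of [nth] is never
    reached. *)
Definition consistent h (j : 'I_n) (y : X) :=
  all (fun s => bc j y (take s h) == nth [ffun=> false] h s j) (iota 0 (size h)).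

Lemma consistent_rcons h z j y :
  consistent (rcons h z) j y = consistent h j y && (bc j y h == z j).
Proof.
rewrite /consistent size_rcons -addn1 iotaD all_cat /= add0n andbT.
congr (_ && _); last by rewrite nth_rcons ltnn eqxx -cats1 take_size_cat.
apply: eq_in_all => s; rewrite mem_iota /= add0n => ls.
by rewrite -cats1 takel_cat 1?ltnW // nth_cat ls.
Qed.

(** The rectangle property: given the earlier history, a new bit depends on its sender's input
    alone, so each round adds one separate condition per processor. *)
Lemma play_eqE x h : (play x (size h) == h) = [forall j, consistent h j (x j)].
Proof.
elim/last_ind: h => [|h z IHh]; first by rewrite eqxx; apply/esym/forallP.
rewrite size_rcons /= eqseq_rcons.
under eq_forallb => j do rewrite consistent_rcons.
have -> : [forall j, consistent h j (x j) && (bc j (x j) h == z j)]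
    = [forall j, consistent h j (x j)] && [forall j, bc j (x j) h == z j].
  apply/forallP/andP => [hj|[/forallP h1 /forallP h2] j]; last by rewrite h1 h2.
  by split; apply/forallP => j; have /andP[] := hj j.
rewrite -IHh; have [-> /=|//] := eqVneq (play x (size h)) h.
apply/eqP/forallP => [<- j|hz]; first by rewrite ffunE.
by apply/ffunP => j; rewrite ffunE; apply/eqP.
Qed.

(** By induction on rounds: equal histories and inputs give equal bits from every processor but [j],
    whose bits agree by hypothesis. *)
Lemma play_inj x x' j t : (forall k, k != j -> x k = x' k) ->
  [seq z j | z : {ffun 'I_n -> bool} <- play x t]
    = [seq z j | z : {ffun 'I_n -> bool} <- play x' t] ->
  play x t = play x' t.
Proof.
move=> xx'; elim: t => //= t IHt; rewrite !map_rcons => /rcons_inj[/IHt <-].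
rewrite !ffunE => ej; congr rcons; apply/ffunP => k; rewrite !ffunE.
by have [->|/xx' ->] := eqVneq k j.
Qed.


End Play.

(** * Counting over all transcripts *)

Section Counting.
Variables (R : realFieldType) (n : nat) (bc : 'I_n -> 'rV['F_2]_n -> history n -> bool).
Variable t : nat.

Definition play_mx (A : 'M['F_2]_n) := play bc (fun j => row j A) t.

Lemma size_play_mx A : size (play_mx A) == t.
Proof. by rewrite size_play. Qed.

(** Tuples of fixed length make the transcripts a finite type to sum over. *)
Definition play_tuple A : t.-tuple {ffun 'I_n -> bool} := Tuple (size_play_mx A).

Definition rect_of (h : t.-tuple {ffun 'I_n -> bool}) (j : 'I_n) : {pred 'rV['F_2]_n} :=
  consistent bc h j.

Lemma in_rect_ofE h A : in_rect (rect_of h) A = (play_tuple A == h).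
Proof.
rewrite -val_eqE /= /play_mx; have := play_eqE bc (fun j => row j A) h.
by rewrite size_tuple => ->.
Qed.

Lemma sum_play_tuple (f : 'M['F_2]_n -> R) (g : pred (seq {ffun 'I_n -> bool})) :
  \sum_(A : 'M['F_2]_n) (g (play_mx A))%:R * f A
  = \sum_(h : t.-tuple {ffun 'I_n -> bool} | g h)
      \sum_(A : 'M['F_2]_n) (in_rect (rect_of h) A)%:R * f A.
Proof.
transitivity (\sum_(A : 'M['F_2]_n | g (play_mx A)) f A).
  by rewrite [RHS]big_mkcond; apply: eq_bigr => A _; case: ifP; rewrite ?mul1r ?mul0r.
rewrite (partition_big play_tuple (fun h => g h)) //=; apply: eq_bigr => h gh.
rewrite big_mkcond; apply: eq_bigr => A _; rewrite in_rect_ofE.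
have [eh|_] := eqVneq (play_tuple A) h; last by rewrite andbF mul0r.
by rewrite andbT mul1r; move: gh; rewrite -eh /= => ->.
Qed.

(* The row of index [j] is recovered from the other rows and the bits of
   processor [j], which together determine the transcript. *)
Lemma sum_rect_rep j :
  \sum_(h : t.-tuple {ffun 'I_n -> bool}) \sum_(A : 'M['F_2]_n)
     (in_rect (rect_of h) A && (row j A == rep (rect_of h j)))%:R
  <= 2 ^+ t * 2 ^+ (n.-1 * n) :> R.
Proof.
pose Q := [pred A : 'M['F_2]_n | row j A == rep (rect_of (play_tuple A) j)].
rewrite exchange_big /=.
have -> : \sum_(A : 'M['F_2]_n) \sum_(h : t.-tuple {ffun 'I_n -> bool})
     (in_rect (rect_of h) A && (row j A == rep (rect_of h j)))%:R = #|Q|%:R :> R.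
  rewrite -sum1_card natr_sum [RHS]big_mkcond; apply: eq_bigr => A _.
  rewrite (bigD1 (play_tuple A)) //= big1 ?addr0.
    by rewrite in_rect_ofE eqxx inE; case: (_ == _).
  by move=> h; rewrite in_rect_ofE eq_sym => /negbTE ->.
pose code A := ([tuple of [seq z j | z : {ffun 'I_n -> bool} <- play_tuple A]], row' j A).
have -> : 2 ^+ t * 2 ^+ (n.-1 * n) = #|{: t.-tuple bool * 'M['F_2]_(n.-1, n)}|%:R :> R.
  by rewrite card_prod card_tuple card_bool card_mx card_F2 natrM !natrX.
rewrite ler_nat; apply: (@leq_card_in _ _ code) => A B.
rewrite !inE => /eqP QA /eqP QB [codeAB rowAB].
have offj k : k != j -> row k A = row k B.
  case: (unliftP j k) => [k' -> _|-> /eqP //].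
  by apply/rowP => l; have := congr1 (fun M : 'M['F_2]_(n.-1, n) => M k' l) rowAB; rewrite !mxE.
have playAB : play_tuple A = play_tuple B.
  by apply: val_inj; exact: play_inj offj codeAB.
apply/row_matrixP => k; have [->|/offj //] := eqVneq k j.
by rewrite QA QB playAB.
Qed.

(** The rectangle bound is summed over the transcripts accepted by [g]. The error terms are
    nonnegative, so they may be summed over all transcripts, where each row [j] costs at most
    [2 ^+ t * 2 ^+ (n.-1 * n)]. *)
Lemma play_ker_count_ge (eps : R) (g : pred (seq {ffun 'I_n -> bool})) : 0 < eps ->
  (2 ^+ n - 1 - 2 ^+ n * n%:R * eps / 2) * \sum_(A : 'M['F_2]_n) (g (play_mx A))%:R
    - n%:R * 2 ^+ t / (2 * eps) * 2 ^+ (n * n)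
  <= 2 ^+ n * \sum_(A : 'M['F_2]_n) (g (play_mx A))%:R * ker_count R A.
Proof.
move=> eps0; set c : R := _ - _ - _.
have -> : \sum_(A : 'M['F_2]_n) (g (play_mx A))%:R
   = \sum_(h : t.-tuple {ffun 'I_n -> bool} | g h)
      \sum_(A : 'M['F_2]_n) (in_rect (rect_of h) A)%:R * 1 :> R.
  by rewrite -sum_play_tuple; apply: eq_bigr => A _; rewrite mulr1.
rewrite sum_play_tuple [leRHS]mulr_sumr.
pose E h j := \sum_(A : 'M['F_2]_n)
  (in_rect (rect_of h) A && (row j A == rep (rect_of h j)))%:R : R.
have E0 h j : 0 <= E h j by apply: sumr_ge0.
apply: le_trans (ler_sum _ (fun h _ => rect_ker_count_ge (rect_of h) eps0)).
rewrite sumrB -mulr_sumr; apply: lerB.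
  rewrite mulr_sumr; apply: ler_sum => h _.
  by rewrite -!mulr_suml mulr1 mulrC.
have sqr_split : 2 ^+ (n * n) * n%:R = 2 ^+ n * 2 ^+ (n.-1 * n) * n%:R :> R.
  by case: n => [|m]; rewrite ?mulr0 //= -exprD; congr (_ ^+ _ * _); lia.
have -> : n%:R * 2 ^+ t / (2 * eps) * 2 ^+ (n * n)
    = 2 ^+ n / (2 * eps) * (n%:R * (2 ^+ t * 2 ^+ (n.-1 * n))) :> R.
  transitivity (2 ^+ t / (2 * eps) * (2 ^+ (n * n) * n%:R)); first by field; rewrite gt_eqF.
  by rewrite sqr_split; field; rewrite gt_eqF.
rewrite ler_wpM2l ?divr_ge0 ?exprn_ge0 ?mulr_ge0 ?(ltW eps0) //.
apply: (@le_trans _ _ (\sum_h \sum_j E h j)).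
  rewrite [leRHS](bigID (fun h : t.-tuple _ => g h)) /= ler_wpDr //.
  by do 2!apply: sumr_ge0 => ? _.
rewrite exchange_big /= -[n in n%:R]card_ord -sum1_card natr_sum mulr_suml.
by apply: ler_sum => j _; rewrite mul1r; exact: sum_rect_rep.
Qed.

Lemma play_full_rank_le (g : pred (seq {ffun 'I_n -> bool})) :
  (40 <= n)%N -> (20 * t <= n + 20)%N ->
  \sum_(A : 'M['F_2]_n) (g (play_mx A) == full_rank A)%:R
  <= 99 / 100 * 2 ^+ (n * n) :> R.
Proof.
move=> n40 tn.
(* With [q] the integer part of [n / 20], the left side is at most [2 ^ (3 * q + 25)], and
   [3 * q + 25 <= 20 * q] once [q >= 2], which [40 <= n] ensures. The exponent 14 covers the factor
   100 * 101. *)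
have small : 100 * (1 + 100 * n%:R ^+ 2 * 2 ^+ t) <= 2 ^+ n :> R.
  rewrite -!natrX -!natrM -[1 + _](natrD _ 1%N) -!natrM ler_nat.
  set q := (n %/ 20)%N.
  have q2 : (2 <= q)%N by rewrite /q; lia.
  have tq : (t <= q.+1)%N by rewrite /q; lia.
  have nq : (n <= 2 ^ (q + 5))%N.
    have : (q.+1 <= 2 ^ q)%N by rewrite ltn_expl.
    by rewrite expnD /q; lia.
  have t2 : (2 ^ t <= 2 ^ q.+1)%N by rewrite leq_exp2l.
  have nn : (n ^ 2 <= 2 ^ (q + 5) * 2 ^ (q + 5))%N by rewrite -mulnn leq_mul.
  have qn : (2 ^ (q * 20) <= 2 ^ n)%N by rewrite leq_exp2l // /q; lia.
  have big : (2 ^ 14 * (2 ^ (q + 5) * 2 ^ (q + 5) * 2 ^ q.+1) <= 2 ^ (q * 20))%N.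
    by rewrite -!expnD leq_exp2l //; lia.
  have : (n ^ 2 * 2 ^ t <= 2 ^ (q + 5) * 2 ^ (q + 5) * 2 ^ q.+1)%N by rewrite leq_mul.
  have : (0 < n ^ 2 * 2 ^ t)%N by rewrite muln_gt0 !expn_gt0; lia.
  by lia.
have n0 : 0 < n%:R :> R by rewrite ltr0n; lia.
(* This [eps] gives a relative loss of 1/400 and an error term [100 * n^2 * 2^t], which [small]
   controls. *)
have eps0 : 0 < (200 * n%:R)^-1 :> R by rewrite invr_gt0 mulr_gt0.
have U0 : 0 < 2 ^+ (n * n) :> R by rewrite exprn_gt0.
have N0 : 0 < 2 ^+ n :> R by rewrite exprn_gt0.
have full := full_rank_density R (leq_trans (isT : (4 <= 40)%N) n40).
have ker := play_ker_count_ge g eps0.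
have sqr := sum_ker_count_sqr R n.
rewrite natr_card_mx in sqr.
set o := \sum_(A : 'M['F_2]_n) (g (play_mx A))%:R in ker.
set ok := \sum_(A : 'M['F_2]_n) _ * _ in ker.
set f := \sum_(A : 'M['F_2]_n) _ in full.
set k2 := \sum_(A : 'M['F_2]_n) _ in sqr.
have oU : o <= 2 ^+ (n * n).
  rewrite -natr_card_mx -sum1_card natr_sum; apply: ler_sum => A _.
  by rewrite ler_nat leq_b1.
(* On full-rank matrices the kernel count [k] is 0 and equality holds; on singular ones an output 1
   leaves [2 - k + k^2 / 8 = (k - 4)^2 / 8 >= 0]. *)
have pointwise : \sum_(A : 'M['F_2]_n) (g (play_mx A) == full_rank A)%:R
    <= 2 ^+ (n * n) - f + o - ok + k2 / 8.
  rewrite -natr_card_mx -sum1_card natr_sum /f /o /ok /k2 mulr_suml -!sumrN -!big_split /=.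
  apply: ler_sum => A _; have [fA|_] := boolP (full_rank A).
    have -> : ker_count R A = 0.
      rewrite /ker_count big1 // => b b0; case: eqP => //= Ab.
      have uA : A \in unitmx by rewrite -row_free_unit.
      by case/eqP: b0; rewrite -(mulKmx uA b) Ab mulmx0.
    by case: (g _); rewrite /= ?mulr0 ?expr0n /= ?mul0r !(subr0, addr0, subrr, add0r).
  (* k <= 2 + k^2 / 8 *)
  have := sqr_ge0 (ker_count R A - 4); have := sqr_ge0 (ker_count R A).
  by case: (g _); rewrite /= ?mul1r ?mul0r !expr2; move: (ker_count R A) => k; nra.
(* In units of [2 ^+ (n * n)] the total is at most [1 - 0.273 + 2/8 + 1/400 + 1/100 = 0.9895]. *)
apply: le_trans pointwise _.
rewrite (_ : _ / (200 * n%:R) / 2 = 2 ^+ n / 400) in ker; last by field; rewrite gt_eqF.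
rewrite (_ : _ / (2 / (200 * n%:R)) = 100 * n%:R ^+ 2 * 2 ^+ t) in ker; last first.
  by field; rewrite gt_eqF.
rewrite -subr_ge0 -(pmulr_rge0 _ N0).
move: small full sqr oU ker U0 N0; move: (2 ^+ (n * n)) (2 ^+ n) (_ * 2 ^+ t) => U N w.
move=> small full sqr oU ker U0 N0.
have h1 : 0 <= (N - 100 * (1 + w)) * U by rewrite mulr_ge0 ?subr_ge0 ?(ltW U0).
have h2 : 0 <= (f - 273 / 1000 * U) * N by rewrite mulr_ge0 ?subr_ge0 ?(ltW N0).
have h3 : 0 <= (2 * U - k2) * N by rewrite mulr_ge0 ?subr_ge0 ?(ltW N0).
have h4 : 0 <= (U - o) * (1 + N / 400).
  by rewrite mulr_ge0 ?subr_ge0 // addr_ge0 // divr_ge0 // ltW.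
have h5 : 0 <= U * N by rewrite mulr_ge0 // ltW.
lra.
Qed.

End Counting.

(** * Reduction to deterministic play for fixed random bits *)

Local Open Scope classical_set_scope.

(* The output is treated as the bit broadcast in one additional round. *)
Definition play_protocol n X (p : protocol n X) (c : 'I_n -> bits)
    (j : 'I_n) (y : X) (h : history n) : bool :=
  if (size h < rounds p)%N then broadcast p j y (c j) h else output p j y (c j) h.

Lemma play_protocolE n X (p : protocol n X) x c t : (t <= rounds p)%N ->
  play (play_protocol p c) x t = transcript p x c t.
Proof.
elim: t => //= t IHt lt; rewrite IHt ?(ltnW lt) //; congr rcons.
apply/ffunP => j; rewrite !ffunE /play_protocol.
by rewrite -IHt ?(ltnW lt) // size_play lt.
Qed.

Lemma final_output_play n X (p : protocol n X) x c i :
  final_output p x c i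
  = last [ffun=> false] (play (play_protocol p c) x (rounds p).+1) i.
Proof.
by rewrite /= last_rcons ffunE /play_protocol size_play ltnn play_protocolE.
Qed.

(** The play lasts [rounds p + 1] rounds, which uses up the slack of 20 in the deterministic
    bound. *)
Lemma final_output_full_rank_le (R : realFieldType) n (p : protocol n 'rV['F_2]_n) c i :
  (40 <= n)%N -> (20 * rounds p <= n)%N ->
  \sum_(M : 'M['F_2]_n) (final_output p (fun j => row j M) c i == full_rank M)%:R
  <= 99 / 100 * 2 ^+ (n * n) :> R.
Proof.
move=> n40 pn; have := @play_full_rank_le R n (play_protocol p c) (rounds p).+1
  (fun h => last [ffun=> false] h i) n40.
rewrite (eq_bigr (fun M : 'M['F_2]_n =>
  (final_output p (fun j => row j M) c i == full_rank M)%:R)); last first.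
  by move=> M _; rewrite final_output_play.
by apply; lia.
Qed.

(** * Measurability of the events about a run *)

Section Measurability.
Context {d : measure_display} {T : measurableType d}.
Variables (n : nat) (X : Type) (p : protocol n X) (x : 'I_n -> X).
Variable c : 'I_n -> T -> bits.
Hypothesis mc : forall j, measurable_fun [set: T] (c j).

Lemma measurable_preimage_bool (f : T -> bool) b :
  measurable_fun [set: T] f -> measurable [set w | f w = b].
Proof.
move=> mf; rewrite -[X in measurable X]setTI; apply: (mf _ [set b]) => //.
Qed.

(** After a prescribed history, the next bits are fixed measurable functions of the random bits, so
    each round adds a finite intersection. *)
Lemma measurable_transcript t h :
  measurable [set w | transcript p x (fun j => c j w) t = h].
Proof.
elim: t h => [|t IHt] h.
  rewrite [X in measurable X](_ : _ = if h == [::] then setT else set0); last first.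
    by case: eqP => [->|h0]; apply/seteqP; split => w //= h1; case: h0.
  by case: ifP.
case/lastP: h => [|h z].
  rewrite [X in measurable X](_ : _ = set0) //.
  by apply/seteqP; split => w //= /(congr1 size); rewrite size_rcons.
rewrite [X in measurable X](_ : _ = [set w | transcript p x (fun j => c j w) t = h] `&`
    \bigcap_(j in [set: 'I_n]) [set w | broadcast p j (x j) (c j w) h = z j]); last first.
  apply/seteqP; split => w /=.
    by move=> /rcons_inj[-> <-]; split => // j _ /=; rewrite ffunE.
  by move=> [-> hz]; congr rcons; apply/ffunP => j; rewrite ffunE; exact: hz.
apply: measurableI => //; apply: fin_bigcap_measurable => [|j _]; first exact: finite_finset.
apply: measurable_preimage_bool.
exact: measurableT_comp (measurable_broadcast p j (x j) h) (mc j).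
Qed.

Lemma measurable_final_output i b :
  measurable [set w | final_output p x (fun j => c j w) i = b].
Proof.
rewrite [X in measurable X](_ : _ = \bigcup_h
    ([set w | transcript p x (fun j => c j w) (rounds p) = h] `&`
     [set w | output p i (x i) (c i w) h = b])); last first.
  apply/seteqP; split => w /=; first by exists (transcript p x (fun j => c j w) (rounds p)).
  by move=> [h _ [/= <-]].
apply: countable_bigcupT_measurable => // h; apply: measurableI.
  exact: measurable_transcript.
apply: measurable_preimage_bool.
exact: measurableT_comp (measurable_output p i (x i) h) (mc i).
Qed.

End Measurability.

(** Independence requires the event to lie in the sigma-algebra generated by the random bits, so the
    measurability result is applied with that sigma-algebra on [T]. *)
Lemma g_sigma_preimage_final_output {d} {T : measurableType d} n X (p : protocol n X) x
    (c : 'I_n -> T -> bits) i b :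
  g_sigma_preimage c [set w | final_output p x (fun j => c j w) i = b].
Proof.
pose G := \big[setU/set0]_(j < n) preimage_set_system [set: T] (c j) measurable.
apply: (@measurable_final_output _ (g_sigma_algebraType G) n X p x c) => j _ B mB.
apply: sub_sigma_algebra; rewrite /G (bigD1 j) //=; left; exists B => //.
Qed.

(** * Union bound and expected number of events *)

Section FinitelyManyEvents.
Context {d : measure_display} {T : measurableType d} {R : realType}.
Variables (P : probability T R) (I : finType) (E : I -> set T).
Hypothesis mE : forall k, measurable (E k).
Local Open Scope ereal_scope.

Lemma measure_bigcup_fin_le : P (\bigcup_k E k) <= \sum_k P (E k).
Proof.
have -> : \bigcup_k E k = \big[setU/set0]_k E k.
  rewrite -bigcup_seq; congr bigcup; apply/seteqP; split => // k _ /=.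
  exact: mem_index_enum.
suff [] : measurable (\big[setU/set0]_k E k) /\
    P (\big[setU/set0]_k E k) <= \sum_k P (E k) by [].
elim/big_rec2: _ => [|k y A _ [mA Ay]]; first by rewrite measure0; split.
split; first exact: measurableU.
by apply: (le_trans (measureU2 _ _ _)) => //; exact: leeD2l.
Qed.

(** The sum of the probabilities is the expected number of events that occur. *)
Lemma sum_probability_le (r : R) :
  (forall w, (\sum_k \1_(E k) w <= r)%R) -> \sum_k P (E k) <= r%:E.
Proof.
move=> Er.
have -> : \sum_k P (E k) = \int[P]_w \sum_k (\1_(E k) w)%:E.
  rewrite ge0_integral_sum //=.
  - by apply: eq_bigr => k _; rewrite integral_indic // setIT.
  - by move=> k; apply/measurable_EFinP; exact: measurable_indic.
apply: (@le_trans _ _ (\int[P]_w r%:E)).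
  apply: ge0_le_integral => //=.
  - by move=> w _; apply: sume_ge0 => k _; rewrite lee_fin indicE.
  - apply: emeasurable_sum => k; apply/measurable_EFinP; exact: measurable_indic.
  - by move=> w _; rewrite sumEFin lee_fin.
by rewrite integral_cst //= probability_setT mule1.
Qed.

End FinitelyManyEvents.

Theorem theorem1p4 (R : realType) :
  exists N : nat, forall n : nat, (N <= n)%N ->
  forall (p : protocol n 'rV['F_2]_n), (rounds p)%:R <= n%:R / 20%:R :> R ->
  forall (d : measure_display) (Omega : measurableType d)
    (P : probability Omega R)
    (A : Omega -> 'M['F_2]_n) (c : 'I_n -> Omega -> bits),
  uniform_matrix P A ->
  (forall i : 'I_n, measurable_fun [set: Omega] (c i)) ->
  independent_of_bits P A c ->
  forall i : 'I_n,
    (P [set w | final_output p (fun j => row j (A w)) (fun j => c j w) i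
                = full_rank (A w)]
     <= (99%:R / 100%:R)%:E)%E.
Proof.
exists 40%N => n n40 p pn d Omega P A c unifA mc indep i.
have {}pn : (20 * rounds p <= n)%N.
  by move: pn; rewrite ler_pdivlMr // -natrM ler_nat mulnC.
pose E M := [set w | final_output p (fun j => row j M) (fun j => c j w) i = full_rank M].
have mE M : measurable (E M) by exact: measurable_final_output.
pose U : R := 2 ^+ (n * n).
have U0 : 0 < U by rewrite exprn_gt0.
(* Splitting by the value [M] of the input leaves events [E M] about the random bits alone, to which
   independence applies. *)
rewrite [X in P X](_ : _ = \bigcup_M (A @^-1` [set M] `&` E M)); last first.
  apply/seteqP; split => w /=; first by exists (A w).
  by move=> [M _ [/= ->]].
apply: le_trans (measure_bigcup_fin_le _ _) _.
  by move=> M; apply: measurableI => //; exact: (unifA M).1.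
rewrite (eq_bigr (fun M => (U^-1)%:E * P (E M))%E); last first.
  move=> M _; rewrite indep; last exact: g_sigma_preimage_final_output.
  by rewrite (unifA M).2 natr_card_mx.
rewrite -ge0_sume_distrr //.
have -> : (99 / 100)%:E = ((U^-1)%:E * (99 / 100 * U)%:E)%E :> \bar R.
  by rewrite -EFinM; congr EFin; field; rewrite gt_eqF.
apply: lee_wpmul2l; first by rewrite lee_fin invr_ge0 ltW.
(* For each outcome [w] the random bits are fixed, so the deterministic count applies. *)
apply: sum_probability_le => // w.
apply: le_trans (final_output_full_rank_le R (fun j => c j w) i n40 pn).
apply: ler_sum => M _; rewrite indicE; case: eqP => [_|h]; first by rewrite ler_nat leq_b1.
by rewrite memNset.
Qed.
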